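(* The Lorentzian Lie algebra $(\mathfrak g_4,S_A^-,J)$ is flat with respect to the canonical connection $\nabla^0$, i.e. $R^0_{uv}w=0$ for all $u,v,w\in\mathfrak g_4$.
   Context: $\mathfrak g_4$ is the real Lie algebra with basis $e_1,e_2,e_3,e_4$ and non-zero brackets (up to skew-symmetry) $[e_1,e_2]=e_3$, $[e_1,e_3]=e_4$. $S_A^-$ is the Lorentzian inner product $\langle\cdot,\cdot\rangle$ on $\mathfrak g_4$ whose matrix in $(e_1,e_2,e_3,e_4)$ is $\begin{bmatrix}-1&0&0&0\\0&1&0&0\\0&0&a&b\\0&0&b&c\end{bmatrix}$, where $A=\begin{bmatrix}a&b\\ b&c\end{bmatrix}$ is real symmetric positive definite. Put $d=ac-b^2$ and fix the basis $v_1=e_2$, $v_2=\frac1{\sqrt a}e_3$, $v_3=\frac{-b}{\sqrt{ad}}e_3+\sqrt{\frac ad}\,e_4$, $v_4=e_1$, which is orthonormal: $\langle v_i,v_j\rangle=0$ for $i\ne j$, $\langle v_i,v_i\rangle=1$ for $i=1,2,3$, $\langle v_4,v_4\rangle=-1$. The product structure $J$ is the linear map with $Jv_i=v_i$ for $i=1,2,3$ and $Jv_4=-v_4$. Write $\mathfrak g$ for the Lie algebra. The Levi-Civita connection is the bilinear map $\nabla:\mathfrak g\times\mathfrak g\to\mathfrak g$ with $2\langle\nabla_uv,w\rangle=\langle[u,v],w\rangle+\langle[w,u],v\rangle+\langle[w,v],u\rangle$ for all $u,v,w$. Put $(\nabla_uJ)v=\nabla_u(Jv)-J(\nabla_uv)$.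 The canonical connection is $\nabla^0_uv=\nabla_uv-\frac12(\nabla_uJ)Jv$, and its curvature is $R^0_{uv}w=\nabla^0_{[u,v]}w-\nabla^0_u\nabla^0_vw+\nabla^0_v\nabla^0_uw$. *)

(* Defs.v *)
From HB Require Import structures.
From mathcomp Require Import all_boot all_order all_algebra.
From mathcomp Require Import ring lra.

Set Implicit Arguments.
Unset Strict Implicit.
Unset Printing Implicit Defensive.

Import Order.TTheory GRing.Theory Num.Theory.
Local Open Scope ring_scope.

Section InnerProduct.
Variables (R : numDomainType) (n : nat).

Definition inner (S : 'M[R]_n) (u v : 'rV[R]_n) : R := (u *m S *m v^T) 0 0.

Definition symposdef (S : 'M[R]_n) : Prop :=
  S^T = S /\ forall x : 'rV[R]_n, x != 0 -> 0 < inner S x x.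

End InnerProduct.

Section Geometry.
Variables (R : fieldType) (V : lmodType R).
(* Lie bracket and inner product on V. *)
Variables (br : V -> V -> V) (ip : V -> V -> R).

Definition is_levi_civita (nabla : {bilinear V -> V -> V}) : Prop :=
  forall u v w : V,
    2 * ip (nabla u v) w = ip (br u v) w + ip (br w u) v + ip (br w v) u.

Definition nablaJ (nabla : V -> V -> V) (J : V -> V) (u v : V) : V :=
  nabla u (J v) - J (nabla u v).

Definition nabla0 (nabla : V -> V -> V) (J : V -> V) (u v : V) : V :=
  nabla u v - (1 / 2) *: nablaJ nabla J u (J v).

(* The sign is opposite to the most common convention for the curvature. *)
Definition curvature (D : V -> V -> V) (u v w : V) : V :=
  D (br u v) w - D u (D v w) + D v (D u w).

End Geometry.

Section G4.
Variable R : rcfType.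

Definition e1 : 'rV[R]_4 := delta_mx 0 0.
Definition e2 : 'rV[R]_4 := delta_mx 0 1.
Definition e3 : 'rV[R]_4 := delta_mx 0 2.
Definition e4 : 'rV[R]_4 := delta_mx 0 3.

(* Bilinear alternating extension of [e1, e2] = e3, [e1, e3] = e4, all the
   other brackets of basis vectors being zero; coordinates are numbered from
   0. *)
Definition g4_br (u v : 'rV[R]_4) : 'rV[R]_4 :=
  (u 0 0 * v 0 1 - u 0 1 * v 0 0) *: e3 + (u 0 0 * v 0 2 - u 0 2 * v 0 0) *: e4.

Definition SAm (A : 'M[R]_2) : 'M[R]_4 :=
  block_mx (block_mx (-1)%:M 0 0 1%:M : 'M[R]_(1 + 1)) 0 0 A : 'M[R]_(2 + 2).

Section Frame.
Variable A : 'M[R]_2.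
Let a := A 0 0.
Let b := A 0 1.
Let c := A 1 1.
Let d := a * c - b ^+ 2.

Definition v1 : 'rV[R]_4 := e2.
Definition v2 : 'rV[R]_4 := (1 / Num.sqrt a) *: e3.
Definition v3 : 'rV[R]_4 :=
  (- b / Num.sqrt (a * d)) *: e3 + Num.sqrt (a / d) *: e4.
Definition v4 : 'rV[R]_4 := e1.

Definition is_product_structure (J : {linear 'rV[R]_4 -> 'rV[R]_4}) : Prop :=
  [/\ J v1 = v1, J v2 = v2, J v3 = v3 & J v4 = - v4].

End Frame.

Lemma ord4P (P : 'I_4 -> Prop) : P 0 -> P 1 -> P 2 -> P 3 -> forall i, P i.
Proof.
move=> P0 P1 P2 P3 [[|[|[|[|//]]]] ilt].
- by rewrite (_ : Ordinal _ = 0) //; apply: val_inj.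
- by rewrite (_ : Ordinal _ = 1) //; apply: val_inj.
- by rewrite (_ : Ordinal _ = 2) //; apply: val_inj.
- by rewrite (_ : Ordinal _ = 3) //; apply: val_inj.
Qed.

Lemma row4P (u v : 'rV[R]_4) :
  u 0 0 = v 0 0 -> u 0 1 = v 0 1 -> u 0 2 = v 0 2 -> u 0 3 = v 0 3 -> u = v.
Proof. by move=> *; apply/rowP; apply: ord4P. Qed.

Lemma sum4 (F : 'I_4 -> R) : \sum_i F i = F 0 + F 1 + F 2 + F 3.
Proof.
rewrite !big_ord_recl big_ord0 addr0 !addrA.
by congr (F _ + F _ + F _ + F _); apply: val_inj.
Qed.

Lemma g4_br12 : g4_br e1 e2 = e3.
Proof. by apply: row4P; rewrite !mxE /=; ring. Qed.
Lemma g4_br13 : g4_br e1 e3 = e4.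
Proof. by apply: row4P; rewrite !mxE /=; ring. Qed.
Lemma g4_br14 : g4_br e1 e4 = 0.
Proof. by apply: row4P; rewrite !mxE /=; ring. Qed.
Lemma g4_br23 : g4_br e2 e3 = 0.
Proof. by apply: row4P; rewrite !mxE /=; ring. Qed.
Lemma g4_br24 : g4_br e2 e4 = 0.
Proof. by apply: row4P; rewrite !mxE /=; ring. Qed.
Lemma g4_br34 : g4_br e3 e4 = 0.
Proof. by apply: row4P; rewrite !mxE /=; ring. Qed.

Lemma g4_br_alt u : g4_br u u = 0.
Proof. by apply: row4P; rewrite !mxE /=; ring. Qed.

Lemma g4_br_bilinear : bilinear_for *:%R *:%R g4_br.
Proof. by split=> z k u v; apply: row4P; rewrite !mxE /=; ring. Qed.

Lemma g4_jacobi u v w :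
  g4_br u (g4_br v w) + g4_br v (g4_br w u) + g4_br w (g4_br u v) = 0.
Proof. by apply: row4P; rewrite !mxE /=; ring. Qed.

Lemma SAmE (A : 'M[R]_2) :
  let S := SAm A in
  [/\ S 0 0 = -1, S 0 1 = 0, S 0 2 = 0 & S 0 3 = 0] /\
  [/\ S 1 0 = 0, S 1 1 = 1, S 1 2 = 0 & S 1 3 = 0] /\
  [/\ S 2 0 = 0, S 2 1 = 0, S 2 2 = A 0 0 & S 2 3 = A 0 1] /\
  [/\ S 3 0 = 0, S 3 1 = 0, S 3 2 = A 1 0 & S 3 3 = A 1 1].
Proof.
have i0 : (0 : 'I_4) = @lshift 2 2 (@lshift 1 1 ord0) by apply: val_inj.
have i1 : (1 : 'I_4) = @lshift 2 2 (@rshift 1 1 ord0) by apply: val_inj.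
have i2 : (2 : 'I_4) = @rshift 2 2 0 by apply: val_inj.
have i3 : (3 : 'I_4) = @rshift 2 2 1 by apply: val_inj.
rewrite /SAm i3 i2 i1 i0.
by do !split;
   rewrite ?(@block_mxEul R 2 2 2 2, @block_mxEur R 2 2 2 2,
             @block_mxEdl R 2 2 2 2, @block_mxEdr R 2 2 2 2)
           ?(@block_mxEul R 1 1 1 1, @block_mxEur R 1 1 1 1,
             @block_mxEdl R 1 1 1 1, @block_mxEdr R 1 1 1 1)
           ?mxE ?eqxx ?mulr1n.
Qed.

Lemma inner_SAm (A : 'M[R]_2) u v : A^T = A ->
  inner (SAm A) u v = - (u 0 0 * v 0 0) + u 0 1 * v 0 1 + A 0 0 * (u 0 2 * v 0 2)
    + A 0 1 * (u 0 2 * v 0 3 + u 0 3 * v 0 2) + A 1 1 * (u 0 3 * v 0 3).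
Proof.
move=> /matrixP/(_ 0 1); rewrite mxE => As.
have [[s00 s01 s02 s03] [[s10 s11 s12 s13] [[s20 s21 s22 s23]]]] := SAmE A.
move=> [s30 s31 s32 s33].
rewrite /inner mxE sum4 !mxE !sum4.
rewrite s00 s01 s02 s03 s10 s11 s12 s13 s20 s21 s22 s23 s30 s31 s32 s33 As.
ring.
Qed.

Section Check.
Variable A : 'M[R]_2.
Hypothesis Apos : symposdef A.
Let a := A 0 0.
Let b := A 0 1.
Let c := A 1 1.
Let d := a * c - b ^+ 2.

Let As : A^T = A. Proof. by case: Apos. Qed.

Let Apos2 (x y : R) : (x != 0) || (y != 0) ->
  0 < a * x ^+ 2 + 2 * b * x * y + c * y ^+ 2.
Proof.
move=> xy0.
have A10 : A 1 0 = A 0 1 by have /matrixP/(_ 0 1) := As; rewrite mxE.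
have i1 : lift ord0 ord0 = 1 :> 'I_2 by apply: val_inj.
have := Apos.2 (\row_j if j == 0 then x else y); rewrite /inner.
rewrite mxE !big_ord_recl big_ord0 !mxE !big_ord_recl !big_ord0 !mxE /= !i1 A10.
rewrite -/a -/b -/c.
have -> : a * x ^+ 2 + 2 * b * x * y + c * y ^+ 2 =
  (x * a + (y * b + 0)) * x + ((x * b + (y * c + 0)) * y + 0) by ring.
apply; apply: contraL xy0 => /eqP/rowP h.
have := h 0; have := h 1; rewrite !mxE /= => -> ->.
by rewrite eqxx.
Qed.

Let a_gt0 : 0 < a.
Proof. by have := @Apos2 1 0; rewrite oner_neq0 => /(_ isT); lra. Qed.

Let d_gt0 : 0 < d.
Proof.
have := @Apos2 (- b) a; rewrite (gt_eqF a_gt0) orbT => /(_ isT) h.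
rewrite -(pmulr_rgt0 _ a_gt0) /d.
by have -> : a * (a * c - b ^+ 2) =
  a * (- b) ^+ 2 + 2 * b * - b * a + c * a ^+ 2 by ring.
Qed.

Let ip := inner (SAm A).

Lemma frame_orthonormal :
  [/\ ip v1 v1 = 1, ip (v2 A) (v2 A) = 1, ip (v3 A) (v3 A) = 1
    & ip v4 v4 = -1] /\
  [/\ ip v1 (v2 A) = 0, ip v1 (v3 A) = 0 & ip v1 v4 = 0] /\
  [/\ ip (v2 A) (v3 A) = 0, ip (v2 A) v4 = 0 & ip (v3 A) v4 = 0].
Proof.
have sa : Num.sqrt a ^+ 2 = a by rewrite sqr_sqrtr // ltW.
have sd : Num.sqrt d ^+ 2 = d by rewrite sqr_sqrtr // ltW.
have sa0 : Num.sqrt a != 0 by rewrite gt_eqF // sqrtr_gt0.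
have sd0 : Num.sqrt d != 0 by rewrite gt_eqF // sqrtr_gt0.
have cE : c = (d + b ^+ 2) / a by rewrite /d; field; rewrite gt_eqF.
have sad : Num.sqrt (a * d) = Num.sqrt a * Num.sqrt d by rewrite sqrtrM // ltW.
have sadV : Num.sqrt (a / d) = Num.sqrt a / Num.sqrt d.
  by rewrite sqrtrM ?sqrtrV // ltW.
rewrite /ip !inner_SAm // /v1 /v2 /v3 /v4 -/a -/b -/c -/d sad sadV cE !mxE /=.
move: sa sd sa0 sd0; move: (Num.sqrt a) (Num.sqrt d) => p q sa sd p0 q0.
by rewrite -sd -sa; do !split; field; rewrite ?p0 ?q0.
Qed.

Lemma product_structureE (J : {linear 'rV[R]_4 -> 'rV[R]_4}) :
  is_product_structure A J <->
  forall u, J u = - u 0 0 *: e1 + u 0 1 *: e2 + u 0 2 *: e3 + u 0 3 *: e4.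
Proof.
have sa0 : Num.sqrt a != 0 by rewrite gt_eqF // sqrtr_gt0.
have sad0 : Num.sqrt (a / d) != 0 by rewrite gt_eqF // sqrtr_gt0 divr_gt0.
split=> [[J1 J2 J3 J4] u|JE].
  have Je3 : J e3 = e3.
    have := J2; rewrite /v2 linearZ => /(congr1 (fun x => Num.sqrt a *: x)).
    by rewrite !scalerA -/a mul1r mulfV // !scale1r.
  have Je4 : J e4 = e4.
    have := J3; rewrite /v3 linearD !linearZ /= Je3 => /addrI.
    by move=> /(congr1 (fun x => (Num.sqrt (a / d))^-1 *: x));
       rewrite !scalerA mulVf // !scale1r.
  have uE : u = u 0 0 *: e1 + u 0 1 *: e2 + u 0 2 *: e3 + u 0 3 *: e4.
    by apply: row4P; rewrite !mxE /=; ring.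
  by rewrite {1}uE !linearD !linearZ /= Je3 Je4 [J e1]J4 [J e2]J1 scalerN scaleNr.
by split; rewrite JE; apply: row4P; rewrite !mxE /=; ring.
Qed.

Lemma product_structure_exists :
  exists J : {linear 'rV[R]_4 -> 'rV[R]_4}, is_product_structure A J.
Proof.
pose D := - delta_mx 0 0 + delta_mx 1 1 + delta_mx 2 2 + delta_mx 3 3 : 'M[R]_4.
exists (mulmxr D); apply/product_structureE => u.
by apply: row4P; rewrite /= mxE sum4 !mxE /=; ring.
Qed.

Lemma ip_nondegenerate x y : (forall w, ip x w = ip y w) -> x = y.
Proof.
move=> xy.
have h1 := xy e1; have h2 := xy e2; have h3 := xy e3; have h4 := xy e4.
move: h1 h2 h3 h4; rewrite /ip !inner_SAm // !mxE /= -/a -/b -/c => h1 h2 h3 h4.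
apply: row4P; [lra|lra| |].
- apply/(mulfI (lt0r_neq0 d_gt0)); rewrite /d.
  have -> : (a * c - b ^+ 2) * x 0 2 =
    c * (a * x 0 2 + b * x 0 3) - b * (b * x 0 2 + c * x 0 3) by ring.
  have -> : (a * c - b ^+ 2) * y 0 2 =
    c * (a * y 0 2 + b * y 0 3) - b * (b * y 0 2 + c * y 0 3) by ring.
  by congr (_ * _ - _ * _); lra.
- apply/(mulfI (lt0r_neq0 d_gt0)); rewrite /d.
  have -> : (a * c - b ^+ 2) * x 0 3 =
    a * (b * x 0 2 + c * x 0 3) - b * (a * x 0 2 + b * x 0 3) by ring.
  have -> : (a * c - b ^+ 2) * y 0 3 =
    a * (b * y 0 2 + c * y 0 3) - b * (a * y 0 2 + b * y 0 3) by ring.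
  by congr (_ * _ - _ * _); lra.
Qed.

Lemma levi_civita_unique
    (nabla nabla' : {bilinear 'rV[R]_4 -> 'rV[R]_4 -> 'rV[R]_4}) :
  is_levi_civita g4_br ip nabla -> is_levi_civita g4_br ip nabla' ->
  forall u v, nabla u v = nabla' u v.
Proof.
move=> LC LC' u v; apply: ip_nondegenerate => w.
by apply: (@mulfI _ 2); rewrite ?pnatr_eq0 // LC LC'.
Qed.

Definition koszul (u v w : 'rV[R]_4) : R :=
  (ip (g4_br u v) w + ip (g4_br w u) v + ip (g4_br w v) u) / 2.

(* Recovers a vector x from its products k e_i = <x, e_i>, by inverting the
   Gram matrix of (e1, e2, e3, e4). *)
Definition levi_civita_of (u v : 'rV[R]_4) : 'rV[R]_4 :=
  let k := koszul u v in
  - k e1 *: e1 + k e2 *: e2 + ((c * k e3 - b * k e4) / d) *: e3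
    + ((a * k e4 - b * k e3) / d) *: e4.

Let ip_br u v w : ip (g4_br u v) w =
  (u 0 0 * v 0 1 - u 0 1 * v 0 0) * (a * w 0 2 + b * w 0 3)
  + (u 0 0 * v 0 2 - u 0 2 * v 0 0) * (b * w 0 2 + c * w 0 3).
Proof.
rewrite /ip inner_SAm // -/a -/b -/c.
have -> : g4_br u v 0 0 = 0 by rewrite !mxE /=; ring.
have -> : g4_br u v 0 1 = 0 by rewrite !mxE /=; ring.
have -> : g4_br u v 0 2 = u 0 0 * v 0 1 - u 0 1 * v 0 0 by rewrite !mxE /=; ring.
have -> : g4_br u v 0 3 = u 0 0 * v 0 2 - u 0 2 * v 0 0 by rewrite !mxE /=; ring.
ring.
Qed.

Let koszul_br u v w : koszul u v w =
  ((u 0 0 * v 0 1 - u 0 1 * v 0 0) * (a * w 0 2 + b * w 0 3)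
   + (u 0 0 * v 0 2 - u 0 2 * v 0 0) * (b * w 0 2 + c * w 0 3)
   + ((w 0 0 * u 0 1 - w 0 1 * u 0 0) * (a * v 0 2 + b * v 0 3)
      + (w 0 0 * u 0 2 - w 0 2 * u 0 0) * (b * v 0 2 + c * v 0 3))
   + ((w 0 0 * v 0 1 - w 0 1 * v 0 0) * (a * u 0 2 + b * u 0 3)
      + (w 0 0 * v 0 2 - w 0 2 * v 0 0) * (b * u 0 2 + c * u 0 3))) / 2.
Proof. by rewrite /koszul !ip_br. Qed.

Let eE : [/\ e1 0 0 = 1, e1 0 1 = 0, e1 0 2 = 0 & e1 0 3 = 0] /\
  [/\ e2 0 0 = 0, e2 0 1 = 1, e2 0 2 = 0 & e2 0 3 = 0] /\
  [/\ e3 0 0 = 0, e3 0 1 = 0, e3 0 2 = 1 & e3 0 3 = 0] /\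
  [/\ e4 0 0 = 0, e4 0 1 = 0, e4 0 2 = 0 & e4 0 3 = 1].
Proof. by rewrite /e1 /e2 /e3 /e4; do !split; rewrite mxE. Qed.

Let koszul_e u v :
  [/\ koszul u v e1 = (u 0 1 * (a * v 0 2 + b * v 0 3)
        + u 0 2 * (b * v 0 2 + c * v 0 3) + v 0 1 * (a * u 0 2 + b * u 0 3)
        + v 0 2 * (b * u 0 2 + c * u 0 3)) / 2,
      koszul u v e2 = - (u 0 0 * (a * v 0 2 + b * v 0 3)
        + v 0 0 * (a * u 0 2 + b * u 0 3)) / 2,
      koszul u v e3 = ((u 0 0 * v 0 1 - u 0 1 * v 0 0) * a
        + (u 0 0 * v 0 2 - u 0 2 * v 0 0) * b - u 0 0 * (b * v 0 2 + c * v 0 3)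
        - v 0 0 * (b * u 0 2 + c * u 0 3)) / 2
    & koszul u v e4 = ((u 0 0 * v 0 1 - u 0 1 * v 0 0) * b
        + (u 0 0 * v 0 2 - u 0 2 * v 0 0) * c) / 2].
Proof.
have [[e10 e11 e12 e13] [[e20 e21 e22 e23] [[e30 e31 e32 e33]]]] := eE.
move=> [e40 e41 e42 e43].
split; rewrite koszul_br.
- by rewrite e10 e11 e12 e13; congr (_ / _); ring.
- by rewrite e20 e21 e22 e23; congr (_ / _); ring.
- by rewrite e30 e31 e32 e33; congr (_ / _); ring.
- by rewrite e40 e41 e42 e43; congr (_ / _); ring.
Qed.

Lemma koszulE u v w : koszul u v w =
  w 0 0 * koszul u v e1 + w 0 1 * koszul u v e2 + w 0 2 * koszul u v e3
    + w 0 3 * koszul u v e4.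
Proof.
have [-> -> -> ->] := koszul_e u v.
by rewrite koszul_br !mulrA -!mulrDl; congr (_ / _); ring.
Qed.

Let koszul_linl k u u' v w :
  koszul (k *: u + u') v w = k * koszul u v w + koszul u' v w.
Proof.
have E i : (k *: u + u') 0 i = k * u 0 i + u' 0 i by rewrite !mxE.
by rewrite !koszul_br !E mulrA -mulrDl; congr (_ / _); ring.
Qed.

Let koszul_linr k u v v' w :
  koszul u (k *: v + v') w = k * koszul u v w + koszul u v' w.
Proof.
have E i : (k *: v + v') 0 i = k * v 0 i + v' 0 i by rewrite !mxE.
by rewrite !koszul_br !E mulrA -mulrDl; congr (_ / _); ring.
Qed.

Lemma levi_civita_of_bilinear : bilinear_for *:%R *:%R levi_civita_of.
Proof.
split=> z k u v; rewrite /levi_civita_of /= ?koszul_linl ?koszul_linr.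
- move: (koszul u z) (koszul v z) => K K'.
  by apply: row4P; rewrite !mxE /=; ring.
- move: (koszul z u) (koszul z v) => K K'.
  by apply: row4P; rewrite !mxE /=; ring.
Qed.

Lemma levi_civita_exists :
  exists nabla : {bilinear 'rV[R]_4 -> 'rV[R]_4 -> 'rV[R]_4},
    is_levi_civita g4_br ip nabla.
Proof.
pose B := bilinear_isBilinear.Build R _ _ _ _ _ levi_civita_of
  levi_civita_of_bilinear.
pose L : {bilinear 'rV[R]_4 -> 'rV[R]_4 -> 'rV[R]_4} := HB.pack levi_civita_of B.
exists L => u v w.
rewrite [L u v]/(levi_civita_of u v) /levi_civita_of /=.
rewrite -[RHS](@divfK _ 2) ?pnatr_eq0 // -/(koszul u v w) (koszulE u v w).
move: (koszul u v e1) (koszul u v e2) (koszul u v e3) (koszul u v e4).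
move=> k1 k2 k3 k4; rewrite /ip inner_SAm //.
set x := _ + _ *: e4.
have -> : x 0 0 = - k1 by rewrite !mxE /=; ring.
have -> : x 0 1 = k2 by rewrite !mxE /=; ring.
have -> : x 0 2 = (c * k3 - b * k4) / d by rewrite !mxE /=; ring.
have -> : x 0 3 = (a * k4 - b * k3) / d by rewrite !mxE /=; ring.
rewrite -/a -/b -/c mulrC; congr (_ * _).
have d0 : a * c - b ^+ 2 != 0 := lt0r_neq0 d_gt0.
by rewrite /d; field.
Qed.

End Check.
End G4.

(* Main.v *)
(** Since J^2 = 1, the canonical connection is
    D_u v = (nabla_u v + J nabla_u (J v)) / 2; as J is symmetric, the Koszul
    formula shows that D_u = 0 for every u in the abelian ideal spanned by e2,
    e3, e4. Hence D_u is the e1-coordinate of u times D_(e1): the operators D_u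
    commute with one another and vanish when u is a bracket, so the curvature
    is zero. *)
Require Import Defs.
From mathcomp Require Import all_boot all_order all_algebra reals.
From mathcomp Require Import ring.
Import Order.TTheory GRing.Theory Num.Theory.
Local Open Scope ring_scope.

Section CanonicalConnection.
Set Implicit Arguments.
Unset Strict Implicit.
Context (R : rcfType) (A : 'M[R]_2) (hA : symposdef A).
Context (J : {linear 'rV[R]_4 -> 'rV[R]_4}) (hJ : is_product_structure A J).

Lemma product_structure_coord u :
  [/\ J u 0 0 = - u 0 0, J u 0 1 = u 0 1, J u 0 2 = u 0 2 & J u 0 3 = u 0 3].
Proof.
have /(product_structureE hA)/(_ u) -> := hJ.
by split; rewrite !mxE /=; ring.
Qed.

Lemma product_structureK u : J (J u) = u.
Proof.
have [h0 h1 h2 h3] := product_structure_coord u.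
have [k0 k1 k2 k3] := product_structure_coord (J u).
by apply: row4P; rewrite ?k0 ?h0 ?opprK ?k1 ?k2 ?k3.
Qed.

(** [J] only reverses the [e1]-axis, which is orthogonal to the span of [e2], [e3], [e4]. *)
Lemma product_structure_sym u v :
  inner (SAm A) (J u) v = inner (SAm A) u (J v).
Proof.
have [h0 h1 h2 h3] := product_structure_coord u.
have [k0 k1 k2 k3] := product_structure_coord v.
rewrite !(inner_SAm _ _ hA.1) h0 h1 h2 h3 k0 k1 k2 k3; ring.
Qed.

Context (nabla : {bilinear 'rV[R]_4 -> 'rV[R]_4 -> 'rV[R]_4}).

Lemma nabla0E u v :
  nabla0 nabla J u v = (1 / 2) *: (nabla u v + J (nabla u (J v))).
Proof.
rewrite /nabla0 /nablaJ product_structureK.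
by apply/rowP => i; rewrite !mxE; field.
Qed.

Lemma nabla0Pl k u u' v :
  nabla0 nabla J (k *: u + u') v = k *: nabla0 nabla J u v + nabla0 nabla J u' v.
Proof.
rewrite !nabla0E !linearPl linearP.
by apply/rowP => i; rewrite !mxE; ring.
Qed.

Lemma nabla0Zr k u v : nabla0 nabla J u (k *: v) = k *: nabla0 nabla J u v.
Proof.
rewrite !nabla0E !(linearZ, linearZr_LR) /=.
by rewrite -scalerDr !scalerA mulrC.
Qed.

Hypothesis hnabla : is_levi_civita (@g4_br R) (inner (SAm A)) nabla.

(** When [u 0 0 = 0], each monomial of the Koszul formula paired with [w] has exactly one of the
    factors [v 0 0] and [w 0 0]. Replacing [v], [w] by [J v], [J w] thus flips its sign, and the two
    terms of [nabla0E] cancel. *)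
Lemma nabla0_eq0 (u v : 'rV[R]_4) : u 0 0 = 0 -> nabla0 nabla J u v = 0.
Proof.
move=> u0; apply: (ip_nondegenerate hA) => w.
have innerl x y z k : inner (SAm A) (k *: (x + y)) z =
    k * (inner (SAm A) x z + inner (SAm A) y z).
  by rewrite !(inner_SAm _ _ hA.1) !mxE; ring.
have inner0 z : inner (SAm A) 0 z = 0.
  by rewrite (inner_SAm _ _ hA.1) !mxE; ring.
rewrite nabla0E innerl product_structure_sym inner0.
(* The factor 4 clears the 1/2 of [nabla0E] and leaves on each term the 2 of the Koszul formula. *)
apply: (@mulfI _ 4); first by rewrite pnatr_eq0.
set p := inner _ _ _; set q := inner _ _ _.
have -> : 4 * (1 / 2 * (p + q)) = 2 * p + 2 * q by field.
have brE (x y : 'rV[R]_4) : [/\ g4_br x y 0 0 = 0, g4_br x y 0 1 = 0,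
    g4_br x y 0 2 = x 0 0 * y 0 1 - x 0 1 * y 0 0
  & g4_br x y 0 3 = x 0 0 * y 0 2 - x 0 2 * y 0 0].
  by split; rewrite !mxE /=; ring.
have innerbr (x y z : 'rV[R]_4) : inner (SAm A) (g4_br x y) z =
    (x 0 0 * y 0 1 - x 0 1 * y 0 0) * (A 0 0 * z 0 2 + A 0 1 * z 0 3)
    + (x 0 0 * y 0 2 - x 0 2 * y 0 0) * (A 0 1 * z 0 2 + A 1 1 * z 0 3).
  have [h0 h1 h2 h3] := brE x y.
  by rewrite (inner_SAm _ _ hA.1) h0 h1 h2 h3; ring.
have [h0 h1 h2 h3] := product_structure_coord v.
have [k0 k1 k2 k3] := product_structure_coord w.
rewrite /p /q !hnabla !innerbr h0 h1 h2 h3 k0 k1 k2 k3 u0; ring.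
Qed.

Lemma nabla0_e1 (u v : 'rV[R]_4) : nabla0 nabla J u v = u 0 0 *: nabla0 nabla J (e1 R) v.
Proof.
(* Removing the [e1]-component leaves a vector of the abelian ideal, where [nabla0_eq0] applies. *)
have h : (u - u 0 0 *: e1 R) 0 0 = 0 by rewrite !mxE /=; ring.
have -> : nabla0 nabla J u v =
    nabla0 nabla J (u 0 0 *: e1 R + (u - u 0 0 *: e1 R)) v.
  by rewrite addrC subrK.
by rewrite nabla0Pl (nabla0_eq0 v h) addr0.
Qed.

End CanonicalConnection.

Theorem theorem3p23 (R : realType) (A : 'M[R]_2) (hA : symposdef A)
    (nabla : {bilinear 'rV[R]_4 -> 'rV[R]_4 -> 'rV[R]_4})
    (hnabla : is_levi_civita (@g4_br R) (inner (SAm A)) nabla)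
    (J : {linear 'rV[R]_4 -> 'rV[R]_4}) (hJ : is_product_structure A J) :
  forall u v w : 'rV[R]_4, curvature (@g4_br R) (nabla0 nabla J) u v w = 0.
Proof.
move=> u v w; rewrite /curvature.
have D0 := nabla0_eq0 hA hJ hnabla.
have De1 := nabla0_e1 hA hJ hnabla.
(* A bracket has no [e1]-component. *)
rewrite D0; last by rewrite !mxE /=; ring.
(* Both remaining terms are [u 0 0 * v 0 0] times D_(e1) applied twice to [w], with opposite
   signs. *)
rewrite (De1 v w) (De1 u w) !(nabla0Zr hA hJ) (De1 u) (De1 v).
by rewrite !scalerA mulrC sub0r addNr.
Qed.
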